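(* Let $M$ be a matroid with at least two elements. Then $M$ is $U_{1,2} \oplus U_{1,1}$-connected if and only if $M$ is loopless, has at most one coloop, and has at most one free element.
   Context: A matroid $M$ with $|E(M)| \geq 2$ is $N$-connected if for every pair of distinct elements $e,f \in E(M)$ there is a minor of $M$ isomorphic to $N$ whose ground set contains $\{e,f\}$. An element of $M$ is free if it is not a coloop and every circuit of $M$ containing it is spanning. *)

(* Defs.v *)
From mathcomp Require Import all_boot.

Set Implicit Arguments.
Unset Strict Implicit.
Unset Printing Implicit Defensive.

(* The ground set is a subset of the carrier [T], so that a matroid and all of
   its minors live over the same type. *)
Record matroid (T : finType) := Matroid {
  ground : {set T};
  indep : {set {set T}};
  indep_ground : forall I, I \in indep -> I \subset ground;
  indep0 : set0 \in indep;
  indepS : forall I J : {set T}, J \in indep -> I \subset J -> I \in indep;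
  indep_augment : forall I J : {set T}, I \in indep -> J \in indep -> #|I| < #|J| ->
    exists2 x, x \in J :\: I & x |: I \in indep
}.

Section MatroidTheory.
Variables (T : finType) (M : matroid T).
Implicit Types (X I B C D : {set T}) (e f : T).

Definition basis_of X B :=
  maxset (fun I => (I \in indep M) && (I \subset X)) B.

Definition basis B := basis_of (ground M) B.

Definition rank X := \max_(I in indep M | I \subset X) #|I|.

Definition spanning X := (X \subset ground M) && (rank X == rank (ground M)).

Definition circuit C :=
  minset (fun X => (X \subset ground M) && (X \notin indep M)) C.

Definition loop e := circuit [set e].

Definition coloop e := [forall B, basis B ==> (e \in B)].

Definition free_element e :=
  [&& e \in ground M, ~~ coloop e &
      [forall C, circuit C && (e \in C) ==> spanning C]].

Definition loopless := [forall e in ground M, ~~ loop e].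

Lemma basis_of_card X B B' : basis_of X B -> basis_of X B' -> #|B| = #|B'|.
Proof.
have le A A' : basis_of X A -> basis_of X A' -> #|A'| <= #|A|.
  move=> /maxsetP[/andP[iA sA] maxA] /maxsetP[/andP[iA' sA'] _].
  rewrite leqNgt; apply/negP => /(indep_augment iA iA')[x].
  rewrite inE => /andP[xNA xA'] ixA.
  have := maxA (x |: A); rewrite ixA subUset sub1set (subsetP sA' _ xA') sA.
  move=> /(_ isT (subsetUr _ _)) eqA.
  by move: xNA; rewrite -eqA setU11.
by move=> bB bB'; apply/eqP; rewrite eqn_leq !le.
Qed.

Lemma basis_of_exists X : exists B, basis_of X B.
Proof.
have [B maxB _] := @maxset_exists _ (fun I => (I \in indep M) && (I \subset X))
  set0 (introT andP (conj (indep0 M) (sub0set X))).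
by exists B.
Qed.

Section Delete.
Variable D : {set T}.

Definition delete_indep := [set I in indep M | I \subset ground M :\: D].

Lemma delete_ground I : I \in delete_indep -> I \subset ground M :\: D.
Proof. by rewrite inE => /andP[]. Qed.

Lemma delete0 : set0 \in delete_indep.
Proof. by rewrite inE indep0 sub0set. Qed.

Lemma deleteS I J : J \in delete_indep -> I \subset J -> I \in delete_indep.
Proof.
rewrite !inE => /andP[iJ sJ] sIJ.
by rewrite (indepS iJ sIJ) (subset_trans sIJ sJ).
Qed.

Lemma delete_augment I J : I \in delete_indep -> J \in delete_indep ->
  #|I| < #|J| -> exists2 x, x \in J :\: I & x |: I \in delete_indep.
Proof.
rewrite !inE => /andP[iI sI] /andP[iJ sJ] /(indep_augment iI iJ)[x xJI ixI].
exists x => //; rewrite inE ixI subUset sub1set sI andbT /=.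
by move: xJI; rewrite inE => /andP[_ /(subsetP sJ)].
Qed.

Definition delete := Matroid delete_ground delete0 deleteS delete_augment.
End Delete.

Section Contract.
Variable C : {set T}.

(* Independence in M / C: the union with some (equivalently, any) basis of the
   restriction M|C is independent in M. *)
Definition contract_indep :=
  [set I : {set T} | (I \subset ground M :\: C) &&
    [exists B, basis_of C B && (I :|: B \in indep M)]].

Lemma contract_ground I : I \in contract_indep -> I \subset ground M :\: C.
Proof. by rewrite inE => /andP[]. Qed.

Lemma contract0 : set0 \in contract_indep.
Proof.
rewrite inE sub0set; have [B bB] := basis_of_exists C.
apply/existsP; exists B; rewrite bB set0U.
by case/maxsetP: bB => /andP[].
Qed.

Lemma contractS I J : J \in contract_indep -> I \subset J ->
  I \in contract_indep.
Proof.
rewrite !inE => /andP[sJ /existsP[B /andP[bB iJB]]] sIJ.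
rewrite (subset_trans sIJ sJ); apply/existsP; exists B.
by rewrite bB (indepS iJB) // setSU.
Qed.

Lemma contract_augment I J : I \in contract_indep -> J \in contract_indep ->
  #|I| < #|J| -> exists2 x, x \in J :\: I & x |: I \in contract_indep.
Proof.
rewrite !inE => /andP[sI /existsP[B /andP[bB iIB]]].
move=> /andP[sJ /existsP[B' /andP[bB' iJB']]] ltIJ.
have cardU (K A : {set T}) : K \subset ground M :\: C -> basis_of C A ->
    #|K :|: A| = #|K| + #|A|.
  move=> sK /maxsetP[/andP[_ sA] _]; apply/eqP; rewrite leq_card_setU.
  by apply: disjointWr sA _; move: sK; rewrite subsetD => /andP[].
have ltU : #|I :|: B| < #|J :|: B'|.
  by rewrite !cardU // (basis_of_card bB bB') ltn_add2r.
have [x] := indep_augment iIB iJB' ltU.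
rewrite !inE negb_or => /andP[/andP[xNI xNB] /orP[xJ|xB']] ixIB.
  exists x; first by rewrite inE xNI.
  rewrite inE subUset sub1set (subsetP sJ _ xJ) sI.
  by apply/existsP; exists B; rewrite bB -setUA.
case/maxsetP: bB => /andP[_ sB] maxB.
case/maxsetP: bB' => /andP[_ sB'] _.
have := maxB (x |: B); rewrite subUset sub1set (subsetP sB' _ xB') sB.
rewrite (indepS ixIB) ?setUS ?subsetUr //.
by move=> /(_ isT isT) eqB; move: xNB; rewrite -eqB setU11.
Qed.

Definition contract :=
  Matroid contract_ground contract0 contractS contract_augment.
End Contract.
End MatroidTheory.

Definition minor (T : finType) (M' M : matroid T) :=
  exists C D : {set T},
    [/\ C \subset ground M, D \subset ground M, [disjoint C & D]
      & M' = delete (contract M C) D].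

(* The bijection is between ground sets, not carriers: elements of the carrier
   outside the ground set play no role. *)
Definition isomorphic (T T' : finType) (M : matroid T) (N : matroid T') :=
  exists2 f : {x | x \in ground M} -> {y | y \in ground N},
    bijective f &
    forall X : {set {x | x \in ground M}},
      ([set val x | x in X] \in indep M) = ([set val (f x) | x in X] \in indep N).

Section Uniform.
Variables r n : nat.

Definition uniform_indep := [set I : {set 'I_n} | #|I| <= r].

Lemma uniform_ground I : I \in uniform_indep -> I \subset [set: 'I_n].
Proof. by rewrite subsetT. Qed.

Lemma uniform0 : set0 \in uniform_indep.
Proof. by rewrite inE cards0. Qed.

Lemma uniformS (I J : {set 'I_n}) : J \in uniform_indep -> I \subset J ->
  I \in uniform_indep.
Proof. by rewrite !inE => leJ /subset_leq_card /leq_trans; apply. Qed.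

Lemma uniform_augment (I J : {set 'I_n}) :
  I \in uniform_indep -> J \in uniform_indep -> #|I| < #|J| ->
  exists2 x, x \in J :\: I & x |: I \in uniform_indep.
Proof.
rewrite !inE => _ leJ ltIJ.
have /subsetPn[x xJ xNI] : ~~ (J \subset I).
  by apply: contraL ltIJ => /subset_leq_card; rewrite -leqNgt.
by exists x; rewrite inE ?xNI // cardsU1 xNI (leq_trans ltIJ).
Qed.

Definition uniform :=
  Matroid uniform_ground uniform0 uniformS uniform_augment.
End Uniform.

Section DirectSum.
Variables (T1 T2 : finType) (M1 : matroid T1) (M2 : matroid T2).
Local Notation T := (T1 + T2)%type.

Definition sum_ground : {set T} := (inl @: ground M1) :|: (inr @: ground M2).

Definition sum_indep := [set I : {set T} |
  (inl @^-1: I \in indep M1) && (inr @^-1: I \in indep M2)].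

Lemma sum_indep_ground I : I \in sum_indep -> I \subset sum_ground.
Proof.
rewrite inE => /andP[/indep_ground/subsetP s1 /indep_ground/subsetP s2].
apply/subsetP => -[] x xI; rewrite inE; apply/orP; [left|right].
  by apply: imset_f; apply: s1; rewrite inE.
by apply: imset_f; apply: s2; rewrite inE.
Qed.

Lemma sum_indep0 : set0 \in sum_indep.
Proof. by rewrite inE !preimset0 !indep0. Qed.

Lemma sum_indepS (I J : {set T}) : J \in sum_indep -> I \subset J ->
  I \in sum_indep.
Proof.
rewrite !inE => /andP[i1 i2] sIJ.
by rewrite (indepS i1) ?(indepS i2) // preimsetS.
Qed.

Lemma card_sum_preim (I : {set T}) :
  #|I| = #|[set x | inl x \in I]| + #|[set x | inr x \in I]|.
Proof.
rewrite -!sum1_card big_sumType.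
by congr (_ + _); apply: eq_bigl => x; rewrite inE.
Qed.

Lemma sum_augment (I J : {set T}) :
  I \in sum_indep -> J \in sum_indep -> #|I| < #|J| ->
  exists2 x, x \in J :\: I & x |: I \in sum_indep.
Proof.
rewrite !inE => /andP[iI1 iI2] /andP[iJ1 iJ2] ltIJ.
have [lt1|le1] := ltnP #|inl @^-1: I| #|inl @^-1: J|.
  have [x] := indep_augment iI1 iJ1 lt1.
  rewrite !inE => xJI ixI; exists (inl x); first by rewrite inE.
  rewrite inE; apply/andP; split.
    by apply: indepS ixI _; apply/subsetP => y; rewrite !inE.
  by apply: indepS iI2 _; apply/subsetP => y; rewrite !inE.
have lt2 : #|inr @^-1: I| < #|inr @^-1: J|.
  rewrite ltnNge; apply/negP => le2; move: ltIJ.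
  by rewrite !card_sum_preim ltnNge leq_add.
have [x] := indep_augment iI2 iJ2 lt2.
rewrite !inE => xJI ixI; exists (inr x); first by rewrite inE.
rewrite inE; apply/andP; split.
  by apply: indepS iI1 _; apply/subsetP => y; rewrite !inE.
by apply: indepS ixI _; apply/subsetP => y; rewrite !inE.
Qed.

Definition direct_sum :=
  Matroid sum_indep_ground sum_indep0 sum_indepS sum_augment.
End DirectSum.

Definition matroid_connected (T' : finType) (N : matroid T')
    (T : finType) (M : matroid T) :=
  2 <= #|ground M| /\
  forall e f, e \in ground M -> f \in ground M -> e != f ->
    exists M' : matroid T,
      [/\ minor M' M, isomorphic M' N & [set e; f] \subset ground M'].

(* Main.v *)
(* Write N for U_{1,2} + U_{1,1}.  A minor of M isomorphic to N, with parallel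
   pair {a, b} and coloop c, amounts to a set B such that B + a + c and
   B + b + c are independent while B + a + b is not: contract B and delete
   everything outside B, a, b, c.  In such a configuration the circuit inside
   B + a + b shows that a is neither free nor a coloop, and two elements of a
   common N-minor cannot both be the element c.

   Conversely, let e be neither free nor a coloop, and let K be a nonspanning
   circuit through e.  If f is outside the closure of K, take b in K - e, c = f
   and B = K - {e, b}; if f is in the closure of K, an exchange makes f parallel
   to e after contracting a suitable K - {e, k}, and c is any element outside
   the closure.  Finally, a matroid with a coloop has no spanning circuit, so a
   coloop and a free element never coexist. *)

Require Import Defs.
From mathcomp Require Import all_boot.

Set Implicit Arguments.
Unset Strict Implicit.
Unset Printing Implicit Defensive.

(** * Independent sets, rank, circuits and coloops *)

Section Matroids.
Variables (T : finType) (M : matroid T).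
Implicit Types (B C I J K X : {set T}) (a b c e f x : T).

(** A maximal independent set between [I] and [I :|: J] works: if it were smaller than [J],
    augmentation would enlarge it within the union. *)
Lemma indep_extend I J : I \in indep M -> J \in indep M ->
  exists2 K, K \in indep M & [/\ I \subset K, K \subset I :|: J & #|J| <= #|K|].
Proof.
move=> iI iJ.
have [K maxK sIK] := @maxset_exists _
  (fun K => (K \in indep M) && (K \subset I :|: J)) I
  (introT andP (conj iI (subsetUl I J))).
case/maxsetP: maxK => /andP[iK sK] maxK.
exists K => //; split=> //; rewrite leqNgt; apply/negP.
case/(indep_augment iK iJ) => x; rewrite inE => /andP[xNK xJ] ixK.
have := maxK (x |: K); rewrite ixK subUset sub1set sK inE xJ orbT.
by move=> /(_ isT (subsetUr _ _)) eqK; move: xNK; rewrite -eqK setU11.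
Qed.

(** Augmentation does not say which element it adds; excluding all candidates but [x] makes it yield
    a prescribed independent set. *)
Lemma indep_augment_unique I J x : I \in indep M -> J \in indep M ->
  #|I| < #|J| ->
  (forall y, y \in J -> y \notin I -> y != x -> y |: I \notin indep M) ->
  x |: I \in indep M.
Proof.
move=> iI iJ ltIJ only; have [y] := indep_augment iI iJ ltIJ.
rewrite inE => /andP[yNI yJ] iyI.
have [<- //|neq] := eqVneq y x.
by move: iyI; rewrite (negPf (only y yJ yNI neq)).
Qed.

Lemma leq_rank I X : I \in indep M -> I \subset X -> #|I| <= rank M X.
Proof.
by move=> iI sI; apply: (leq_bigmax_cond (F := fun J : {set T} => #|J|));
  rewrite iI sI.
Qed.

Lemma rank_attained X :
  exists2 I, I \in indep M & I \subset X /\ rank M X = #|I|.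
Proof.
have P0 : (set0 \in indep M) && (set0 \subset X) by rewrite indep0 sub0set.
rewrite /rank (@bigmax_eq_arg _ set0) //.
case: arg_maxnP => [//|I /andP[iI sI] _].
by exists I.
Qed.

Lemma basis_of_rank I : I \in indep M -> rank M (ground M) <= #|I| ->
  basis M I.
Proof.
move=> iI leI; apply/maxsetP; split=> [|J /andP[iJ sJ] sIJ].
  by rewrite iI (indep_ground iI).
by apply/eqP; rewrite eq_sym eqEcard sIJ (leq_trans (leq_rank iJ sJ)).
Qed.

Lemma circuit_dep C : circuit M C -> C \notin indep M.
Proof. by case/minsetP => /andP[]. Qed.

Lemma circuit_ground C : circuit M C -> C \subset ground M.
Proof. by case/minsetP => /andP[]. Qed.

Lemma circuitD1 C x : circuit M C -> x \in C -> C :\ x \in indep M.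
Proof.
case/minsetP => /andP[sC _] minC xC; apply: contraT => dep.
have := minC (C :\ x); rewrite dep (subset_trans (subsetDl _ _) sC).
by move=> /(_ isT (subsetDl _ _)) eqC; move: xC; rewrite -eqC setD11.
Qed.

Lemma dep_circuit X : X \subset ground M -> X \notin indep M ->
  exists2 C, circuit M C & C \subset X.
Proof.
move=> sX dX; have [|C cC sC] := @minset_exists _
  (fun Y => (Y \subset ground M) && (Y \notin indep M)) X; first by rewrite sX.
by exists C.
Qed.

Lemma circuit_rank C : circuit M C -> rank M C < #|C|.
Proof.
move=> cC; have [I iI [sI ->]] := rank_attained C.
by apply: proper_card; rewrite properEneq sI andbT;
  apply: contraTneq iI => ->; exact: circuit_dep.
Qed.

Lemma loopless_indep1 e : loopless M -> e \in ground M -> [set e] \in indep M.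
Proof.
move=> /forall_inP nl eE; apply: contraT => dep.
case/negP: (nl e eE); apply/minsetP; rewrite sub1set eE dep; split=> // C.
case/andP=> _ dC; rewrite subset1 => /orP[/eqP //|/eqP C0].
by rewrite C0 indep0 in dC.
Qed.

(** Adding [x] to a basis that misses it creates a circuit, which must use [x] because the basis is
    independent. *)
Lemma circuit_through x : x \in ground M -> ~~ coloop M x ->
  exists2 C, circuit M C & x \in C.
Proof.
move=> xE /forallPn[B]; rewrite negb_imply => /andP[bB xNB].
have /maxsetP[/andP[iB sB] maxB] := bB.
have sxB : x |: B \subset ground M by rewrite subUset sub1set xE.
have [|C cC sC] := dep_circuit sxB.
  apply/negP => ixB; move: xNB.
  by rewrite -(maxB (x |: B)) ?setU11 ?subsetUr // ixB.
exists C => //; apply: contraT => xNC.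
case/negP: (circuit_dep cC); apply: indepS iB _.
by rewrite -(setU1K xNB) subsetD1 sC.
Qed.

Lemma coloop_circuit_nonspanning e C : coloop M e -> circuit M C ->
  ~~ spanning M C.
Proof.
move=> /forallP col cC; apply/negP => /andP[_ /eqP rC].
(* Removing this [x] from a spanning circuit would leave a basis that avoids [e]. *)
have [x xC eNCx] : exists2 x, x \in C & e \notin C :\ x.
  have [eC|eNC] := boolP (e \in C); first by exists e => //; rewrite setD11.
  have /set0Pn[x xC] : C != set0.
    by apply: contraNneq (circuit_dep cC) => ->; exact: indep0.
  by exists x => //; rewrite in_setD1 (negPf eNC) andbF.
case/negP: eNCx; apply: (implyP (col _)).
apply: basis_of_rank; first exact: circuitD1.
by rewrite -rC -ltnS; have := circuit_rank cC; rewrite (cardsD1 x) xC.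
Qed.

Lemma nonspanning_circuit e : e \in ground M -> ~~ coloop M e ->
  ~~ free_element M e ->
  exists C, [/\ circuit M C, e \in C & ~~ spanning M C].
Proof.
move=> eE ncol; rewrite /free_element eE ncol /= => /forallPn[C].
by rewrite negb_imply => /andP[/andP[cC eC] nsC]; exists C.
Qed.

Lemma coloop_not_free e f : coloop M e -> ~~ free_element M f.
Proof.
move=> col; apply/negP => /and3P[fE ncol /forallP fr].
have [C cC fC] := circuit_through fE ncol.
have := fr C; rewrite cC fC /=; apply/negP.
exact: coloop_circuit_nonspanning col cC.
Qed.

(** * Configurations with a parallel pair and a coloop *)

(* After contracting B and restricting to {a, b, c}, the elements a and b form
   a parallel pair and c is a coloop. *)
Definition pair_coloop B a b c :=
  [/\ c \notin B, a |: (b |: B) \notin indep M, a |: (c |: B) \in indep M &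
      b |: (c |: B) \in indep M].

Lemma pair_coloopC B a b c : pair_coloop B a b c -> pair_coloop B b a c.
Proof. by case=> cNB dab iac ibc; split=> //; rewrite setUCA. Qed.

Lemma pair_coloop_distinct B a b c : pair_coloop B a b c ->
  [/\ a != b, a != c & b != c].
Proof.
case=> cNB dab iac ibc; split; apply: contraNneq dab => eq_.
- rewrite -eq_ setUA setUid; apply: indepS iac _.
  by rewrite setUS // subsetUr.
- by rewrite eq_ setUCA.
- by rewrite eq_.
Qed.

Lemma pair_coloop_notin B a b c : pair_coloop B a b c -> a \notin B.
Proof.
case=> cNB dab iac ibc; apply: contraNN dab => aB.
rewrite (setUidPr _) ?sub1set ?inE ?aB ?orbT //.
by apply: indepS ibc _; rewrite setUS // subsetUr.
Qed.

(** A basis extending [b |: (c |: B)] must avoid [a], since it would otherwise contain the dependent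
    set [a |: (b |: B)]. *)
Lemma pair_coloop_not_coloop B a b c : pair_coloop B a b c -> ~~ coloop M a.
Proof.
move=> [cNB dab iac ibc]; have [I iI [_ rI]] := rank_attained (ground M).
have [K iK [sK _ leK]] := indep_extend ibc iI.
apply: contraNN dab => /forallP/(_ K)/implyP col.
apply: (indepS iK); rewrite !subUset !sub1set.
have -> : a \in K by apply/col/(basis_of_rank iK); rewrite rI.
rewrite (subsetP sK) ?setU11 //=; apply: subset_trans sK.
by rewrite setUA subsetUr.
Qed.

(** A circuit inside [a |: (b |: B)] passes through [a] and has rank below [#|B| + 2], the size of
    the independent set [a |: (c |: B)]. *)
Lemma pair_coloop_not_free B a b c : pair_coloop B a b c ->
  ~~ free_element M a.
Proof.
move=> pc; have [cNB dab iac ibc] := pc.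
have [nab nac nbc] := pair_coloop_distinct pc.
have aNB := pair_coloop_notin pc.
have bNB := pair_coloop_notin (pair_coloopC pc).
have sab : a |: (b |: B) \subset ground M.
  have := indep_ground iac; have := indep_ground ibc.
  by rewrite !subUset => /and3P[-> _ ->] /and3P[-> _ _].
have [C cC sC] := dep_circuit sab dab.
have aC : a \in C.
  apply: contraT => aNC; case/negP: (circuit_dep cC).
  apply: indepS ibc _; apply/subsetP => x xC.
  have := subsetP sC x xC; rewrite !inE.
  by have [xa|_] /= := eqVneq x a; [rewrite -xa xC in aNC
                                |case/orP=> ->; rewrite ?orbT].
apply/negP => /and3P[_ _ /forallP/(_ C)]; rewrite cC aC => /andP[_ /eqP rC].
have := leq_rank iac (indep_ground iac); rewrite -rC leqNgt => /negP; apply.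
apply: leq_trans (circuit_rank cC) (leq_trans (subset_leq_card sC) _).
by rewrite !cardsU1 !inE !negb_or nab nac aNB bNB cNB.
Qed.

Lemma pair_coloop_indep1 B a b c x : pair_coloop B a b c ->
  x \in [set a; b; c] -> [set x] \in indep M.
Proof.
case=> _ _ iac ibc; rewrite !inE -orbA => /or3P[] /eqP ->.
- by apply: indepS iac _; rewrite sub1set !inE eqxx.
- by apply: indepS ibc _; rewrite sub1set !inE eqxx.
- by apply: indepS ibc _; rewrite sub1set !inE eqxx orbT.
Qed.

(** * Exchange along a nonspanning circuit *)

(** When [C :\ f] is augmented from [c |: (C :\ e)], the only candidate besides [c] is [f], which
    would restore the circuit. *)
Lemma circuit_augment_swap C c e f : circuit M C -> c \notin C ->
  e \in C -> f \in C -> c |: (C :\ e) \in indep M -> c |: (C :\ f) \in indep M.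
Proof.
move=> cC cNC eC fC ice.
apply: indep_augment_unique (circuitD1 cC fC) ice _ _.
  rewrite cardsU1 in_setD1 (negPf cNC) andbF ltnS.
  by have := cardsD1 e C; rewrite (cardsD1 f C) eC fC !add1n => -[->].
move=> y; rewrite !inE => /predU1P[->|/andP[_ yC]]; first by rewrite eqxx.
by rewrite yC andbT negbK => /eqP -> _; rewrite setD1K // circuit_dep.
Qed.

Lemma nonspanning_augment C e : circuit M C -> e \in C -> ~~ spanning M C ->
  exists2 c, c \notin C & c |: (C :\ e) \in indep M.
Proof.
move=> cC eC; rewrite /spanning circuit_ground //= => neqr.
have [I iI [sI rI]] := rank_attained (ground M).
have iCe := circuitD1 cC eC.
have ltC : #|C :\ e| < #|I|.
  apply: leq_ltn_trans (leq_rank iCe (subsetDl _ _)) _.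
  rewrite -rI ltn_neqAle neqr; have [J iJ [sJ ->]] := rank_attained C.
  exact: leq_rank iJ (indep_ground iJ).
have [c] := indep_augment iCe iI ltC.
rewrite !inE negb_and negbK => /andP[cN _] ic; exists c => //.
case/orP: cN ic => [/eqP ->|//]; rewrite setD1K // => iC.
by rewrite (negPf (circuit_dep cC)) in iC.
Qed.

(** Extending [[set f]] inside [f |: I] to at least the size of [I] has to drop some [k] of [I], and
    by cardinality drops nothing else. *)
Lemma indep_exchange I f : [set f] \in indep M -> I \in indep M ->
  f \notin I -> f |: I \notin indep M ->
  exists2 k, k \in I & f |: (I :\ k) \in indep M.
Proof.
move=> i1 iI fNI dfI; have [K iK [fK sK leK]] := indep_extend i1 iI.
have /subsetPn[k kI kNK] : ~~ (I \subset K).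
  by apply: contraNN dfI => sIK; apply: indepS iK _; rewrite subUset fK.
exists k => //.
have sKI : K \subset f |: (I :\ k).
  apply/subsetP => x xK; have := subsetP sK x xK; rewrite !inE.
  by have [xk|//] := eqVneq x k; rewrite -xk xK in kNK.
suff <- : K = f |: (I :\ k) by [].
apply/eqP; rewrite eqEcard sKI; apply: leq_trans leK.
by rewrite cardsU1 !inE (negPf fNI) andbF (cardsD1 k I) kI.
Qed.

Lemma nonspanning_pair_coloop C e f : loopless M -> circuit M C -> e \in C ->
  ~~ spanning M C -> f \in ground M -> e != f ->
  exists B a b c, pair_coloop B a b c /\ [set e; f] \subset [set a; b; c].
Proof.
move=> nl cC eC nsC fE nef; have dC := circuit_dep cC.
have iCe := circuitD1 cC eC.
have [c cNC ic] := nonspanning_augment cC eC nsC.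
have neqC x y : x \in C -> y \notin C -> x != y.
  by move=> xC; apply: contraNneq => <-.
have eqCD x y : x \in C -> y \in C -> x != y -> x |: (C :\ x :\ y) = C :\ y.
  move=> xC yC nxy; apply/setP => z; rewrite !inE.
  by have [->|] := eqVneq z x; rewrite ?nxy ?xC.
(* Both elements on [C]: they become parallel once the rest of [C] is contracted, and [c] serves as
   coloop. *)
have [fC|fNC] := boolP (f \in C).
  exists (C :\ e :\ f), e, f, c; split; last by rewrite subsetUl.
  split.
  - by rewrite !inE (negPf cNC) !andbF.
  - by rewrite (setD1K (a := f)) ?setD1K // !inE fC eq_sym nef.
  - by rewrite setUCA eqCD //; exact: circuit_augment_swap ic.
  - by rewrite setUCA (setD1K (a := f)) // !inE fC eq_sym nef.
(* Here [f] is outside the closure of [C] and serves as the coloop; the partner [b] of [e] exists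
   because [e] is not a loop. *)
have [if_|df] := boolP (f |: (C :\ e) \in indep M).
  have /set0Pn[b bCe] : C :\ e != set0.
    apply: contraNneq dC => Ce0; rewrite -(setD1K eC) Ce0 setU0.
    exact: loopless_indep1 nl (subsetP (circuit_ground cC) e eC).
  have [nbe bC] := setD1P bCe.
  exists (C :\ e :\ b), e, b, f; split; last first.
    by rewrite subUset !sub1set !inE !eqxx !orbT.
  split.
  - by rewrite !inE (negPf fNC) !andbF.
  - by rewrite (setD1K (a := b)) ?setD1K.
  - by rewrite setUCA eqCD // 1?eq_sym //; exact: circuit_augment_swap if_.
  - by rewrite setUCA (setD1K (a := b)).
have fNCe : f \notin C :\ e by rewrite !inE (negPf fNC) andbF.
(* Now [f] is in the closure of [C] but not on it; [k] is chosen so that [f] stays independent of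
   the contracted set. *)
have [k kCe ifk] := indep_exchange (loopless_indep1 nl fE) iCe fNCe df.
have [nke kC] := setD1P kCe.
have cardCe : #|C :\ e| = #|C :\ e :\ k|.+1 by rewrite (cardsD1 k) kCe.
have ek : e \notin C :\ e :\ k by rewrite !inE eqxx andbF.
have fk : f \notin C :\ e :\ k by rewrite in_setD1 (negPf fNCe) andbF.
exists (C :\ e :\ k), e, f, c; split; last by rewrite subsetUl.
split.
- by rewrite !inE (negPf cNC) !andbF.
(* Otherwise [C :\ e] could be augmented from this set: [e] would restore [C], so [f] would be
   added, contradicting [df]. *)
- apply: contraNN df => iefk; apply: (indep_augment_unique iCe iefk).
    by rewrite !cardsU1 in_setU1 negb_or nef ek fk cardCe.
  move=> y; rewrite in_setU1 => /predU1P[->|]; first by rewrite setD1K.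
  rewrite in_setU1 => /predU1P[->|]; first by rewrite eqxx.
  by rewrite in_setD1 => /andP[_ ->].
- by rewrite setUCA eqCD // 1?eq_sym //; exact: circuit_augment_swap ic.
(* The only candidate besides [c] is [k], which would restore the dependent [f |: (C :\ e)]. *)
- rewrite setUCA; apply: (indep_augment_unique ifk ic).
    by rewrite !cardsU1 fk cardCe !inE (negPf cNC) andbF.
  move=> y; rewrite in_setU1 => /predU1P[->|yCe]; first by rewrite eqxx.
  have [->|nyk] := eqVneq y k; first by rewrite setUCA setD1K.
  by rewrite in_setU1 in_setD1 nyk yCe orbT.
Qed.

(** * Independence in a contraction *)

(** If another basis [B'] of [C] witnesses independence, extend [B] inside [B :|: (I :|: B')]. The
    result meets [C] only in [B] by maximality, and comparing sizes identifies it with [I :|: B]. *)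
Lemma contract_indep_basis C B I : basis_of M C B ->
  (I \in indep (contract M C)) =
    (I \subset ground M :\: C) && (I :|: B \in indep M).
Proof.
move=> bB; rewrite inE; have [sI|//] := boolP (I \subset _).
apply/existsP/idP => /= [[B' /andP[bB' iIB']]|iIB]; last by exists B; rewrite bB.
have /maxsetP[/andP[iB sB] maxB] := bB.
have /maxsetP[/andP[iB' sB'] _] := bB'.
have [K iK [sBK sK leK]] := indep_extend iB iIB'.
have KC : K :&: C = B.
  apply: maxB; last by rewrite subsetI sBK.
  by rewrite subsetIr andbT; apply: indepS iK _; exact: subsetIl.
have sKI : K \subset I :|: B.
  apply/subsetP => x xK; have [xC|xNC] := boolP (x \in C).
    by rewrite inE -[in X in _ || X]KC inE xK xC orbT.
  have := subsetP sK x xK; rewrite !inE.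
  rewrite (negPf (contraNN (subsetP sB x) xNC)).
  by rewrite (negPf (contraNN (subsetP sB' x) xNC)) /= !orbF.
suff <- : K = I :|: B by [].
apply/eqP; rewrite eqEcard sKI; apply: leq_trans leK.
have dI (A : {set T}) : A \subset C -> #|I :|: A| = #|I| + #|A|.
  move=> sA; apply/eqP; rewrite leq_card_setU; apply: disjointWr sA _.
  by move: sI; rewrite subsetD => /andP[].
by rewrite !dI // (basis_of_card bB bB').
Qed.

End Matroids.

(** * The target matroid and the minors isomorphic to it *)

Section PairColoopMatroid.

Local Notation N := (direct_sum (uniform 1 2) (uniform 1 1)).

(** The parallel pair is [n0], [n1]; the coloop is [n2]. *)
Let n0 : 'I_2 + 'I_1 := inl ord0.
Let n1 : 'I_2 + 'I_1 := inl ord_max.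
Let n2 : 'I_2 + 'I_1 := inr ord0.

Lemma pair_coloop_matroid_cases (y : 'I_2 + 'I_1) :
  [\/ y = n0, y = n1 | y = n2].
Proof.
case: y => [] [[|[|//]] lti]; last by [].
- by constructor 1; congr inl; apply: val_inj.
- by constructor 2; congr inl; apply: val_inj.
- by constructor 3; congr inr; apply: val_inj.
Qed.

Lemma pair_coloop_matroid_ground y : y \in ground N.
Proof. by case: y => i; rewrite inE imset_f ?inE ?orbT. Qed.

Lemma pair_coloop_matroid_indep (Y : {set 'I_2 + 'I_1}) :
  (Y \in indep N) = ~~ ((n0 \in Y) && (n1 \in Y)).
Proof.
rewrite !inE.
have -> : #|inr @^-1: Y| <= 1 by rewrite (leq_trans (max_card _)) ?card_ord.
rewrite andbT.
rewrite -sum1_card (eq_bigl _ _ (fun i => in_set _ i)) big_mkcond.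
rewrite big_ord_recl big_ord1 /=.
have -> : lift ord0 ord0 = ord_max :> 'I_2 by apply: val_inj.
by rewrite -/n0 -/n1; case: (n0 \in Y); case: (n1 \in Y).
Qed.

Variable T : finType.
Implicit Types (M : matroid T) (B : {set T}) (a b c x : T).

Lemma isomorphic_pair_coloop M : isomorphic M N ->
  exists a b c, [/\ ground M = [set a; b; c], [set a; b] \notin indep M,
    [set a; c] \in indep M & [set b; c] \in indep M].
Proof.
case=> h [g hK gK] hindep.
pose s y := g (exist _ y (pair_coloop_matroid_ground y)).
have valhs y : val (h (s y)) = y by rewrite gK.
have pairE y z :
    ([set val (s y); val (s z)] \in indep M) = ([set y; z] \in indep N).
  have := hindep [set s y; s z].
  by rewrite !imsetU1 !imset_set1 !valhs.
exists (val (s n0)), (val (s n1)), (val (s n2)); split.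
- apply/setP => x; apply/idP/idP => [xE|]; last first.
    by rewrite !inE -orbA => /or3P[] /eqP ->; exact: valP.
  pose u : {x | x \in ground M} := exist _ x xE.
  have -> : x = val (s (val (h u))).
    by rewrite -[x]/(val u) -[in LHS](hK u); congr (val (g _)); apply: val_inj.
  rewrite !inE.
  by case: (pair_coloop_matroid_cases (val (h u))) => ->; rewrite eqxx ?orbT.
- by rewrite pairE pair_coloop_matroid_indep !inE !eqxx orbT.
- by rewrite pairE pair_coloop_matroid_indep !inE.
- by rewrite pairE pair_coloop_matroid_indep !inE.
Qed.

Lemma pair_coloop_isomorphic M a b c : ground M = [set a; b; c] ->
  [/\ a != b, a != c & b != c] -> [set a; b] \notin indep M ->
  [set a; c] \in indep M -> [set b; c] \in indep M -> isomorphic M N.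
Proof.
move=> gM [nab nac nbc] dab iac ibc.
pose h0 x := if x == a then n0 else if x == b then n1 else n2.
pose h (x : {x | x \in ground M}) : {y | y \in ground N} :=
  exist _ (h0 (val x)) (pair_coloop_matroid_ground _).
have h0_inj x y : x \in ground M -> y \in ground M -> h0 x = h0 y -> x = y.
  rewrite gM !inE -!orbA => /or3P[] /eqP -> /or3P[] /eqP ->;
  by rewrite /h0 ?eqxx // ?[b == a]eq_sym ?[c == a]eq_sym ?[c == b]eq_sym
    ?(negPf nab) ?(negPf nac) ?(negPf nbc).
have h_inj : injective h.
  move=> x y /(congr1 val) /= eqh; apply: val_inj.
  exact: h0_inj (valP x) (valP y) eqh.
(* Injectivity suffices: the carrier of [N] has three elements, as many as the ground set of [M]. *)
have h_bij : bijective h.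
  apply: inj_card_bij h_inj _; rewrite !card_sig.
  apply: leq_trans (max_card _) _.
  rewrite card_sum !card_ord (eq_card (B := ground M)) // gM.
  by rewrite setUC cardsU1 cards2 nab !inE negb_or ![c == _]eq_sym nac nbc.
exists h => // X; rewrite pair_coloop_matroid_indep.
set Y := [set val x | x in X].
have sY : Y \subset ground M by apply/subsetP => _ /imsetP[x _ ->]; exact: valP.
have memh x : x \in ground M ->
    (h0 x \in [set val (h y) | y in X]) = (x \in Y).
  move=> xE; apply/imsetP/imsetP => [[y yX /= eqh]|[y yX ->]]; exists y => //.
  exact: h0_inj xE (valP y) eqh.
have -> : n0 = h0 a by rewrite /h0 eqxx.
have -> : n1 = h0 b by rewrite /h0 eqxx eq_sym (negPf nab).
rewrite !memh ?gM ?inE ?eqxx ?orbT //.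
(* A set missing [a] lies in [[set b; c]], and one missing [b] in [[set a; c]]; both are
   independent. *)
have [aY|aNY] := boolP (a \in Y); last first.
  apply: indepS ibc _; apply/subsetP => x xY.
  have := subsetP sY x xY; rewrite gM !inE -orbA.
  by case/or3P=> [/eqP xa| -> | ->]; rewrite ?orbT // -xa xY in aNY *.
have [bY|bNY] := boolP (b \in Y); last first.
  apply: indepS iac _; apply/subsetP => x xY.
  have := subsetP sY x xY; rewrite gM !inE -orbA.
  by case/or3P=> [-> |/eqP xb| -> ]; rewrite ?orbT // -xb xY in bNY *.
apply: negbTE; apply: contraNN dab => iY; apply: indepS iY _.
by rewrite subUset !sub1set aY.
Qed.

(** The set [B] is a basis of the contracted set, so a pair is independent in the minor exactly when
    its union with [B] is independent in [M]. *)
Lemma minor_pair_coloop M M' : minor M' M -> isomorphic M' N ->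
  exists B a b c, pair_coloop M B a b c /\ ground M' = [set a; b; c].
Proof.
move=> [C [D [sC sD dCD ->]]] /isomorphic_pair_coloop.
move=> [a [b [c [gM' dab iac ibc]]]].
have [B bB] := basis_of_exists M C; exists B, a, b, c; split=> //.
have /maxsetP[/andP[_ sB] _] := bB.
have del x y : x \in [set a; b; c] -> y \in [set a; b; c] ->
    ([set x; y] \in indep (delete (contract M C) D)) =
      (x |: (y |: B) \in indep M).
  rewrite -gM' /= => xE yE; rewrite inE (contract_indep_basis _ bB).
  have sxy : [set x; y] \subset ground M :\: C :\: D.
    by rewrite subUset !sub1set xE.
  by rewrite sxy (subset_trans sxy (subsetDl _ _)) andbT -setUA.
rewrite !del ?inE ?eqxx ?orbT // in dab iac ibc; split=> //.
have : c \in [set a; b; c] by rewrite !inE eqxx orbT.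
rewrite -gM' /= !inE => /and3P[_ cNC _].
by apply: contraNN cNC => /(subsetP sB).
Qed.

Lemma pair_coloop_minor M B a b c : pair_coloop M B a b c ->
  exists M', [/\ minor M' M, isomorphic M' N & ground M' = [set a; b; c]].
Proof.
move=> pc; have [cNB dab iac ibc] := pc.
have neq := pair_coloop_distinct pc.
have aNB := pair_coloop_notin pc.
have bNB := pair_coloop_notin (pair_coloopC pc).
pose D := ground M :\: (B :|: [set a; b; c]).
have [sa sb sc sB] : [/\ a \in ground M, b \in ground M, c \in ground M
    & B \subset ground M].
  have := indep_ground iac; have := indep_ground ibc.
  by rewrite !subUset !sub1set => /and3P[-> -> ->] /and3P[-> _ _].
have gM' : ground (delete (contract M B) D) = [set a; b; c].
  apply/setP => x; rewrite !inE negb_and !negbK.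
  have [->|_] /= := eqVneq x a; first by rewrite aNB sa ?orbT.
  have [->|_] /= := eqVneq x b; first by rewrite bNB sb ?orbT.
  have [->|_] /= := eqVneq x c; first by rewrite cNB sc ?orbT.
  by rewrite orbF; case: (x \in B); case: (x \in ground M).
(* Being independent, [B] is its own basis, so contracting it tests independence of unions with [B]
   itself. *)
have bB : basis_of M B B.
  apply/maxsetP; split=> [|X /andP[_ sX] sBX]; last first.
    by apply/eqP; rewrite eqEsubset sX.
  rewrite subxx andbT; apply: indepS iac _.
  by rewrite setUA subsetUr.
have del x y : x \in [set a; b; c] -> y \in [set a; b; c] ->
    ([set x; y] \in indep (delete (contract M B) D)) =
      (x |: (y |: B) \in indep M).
  rewrite -gM' /= => xE yE; rewrite inE (contract_indep_basis _ bB).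
  have sxy : [set x; y] \subset ground M :\: B :\: D.
    by rewrite subUset !sub1set xE.
  by rewrite sxy (subset_trans sxy (subsetDl _ _)) andbT -setUA.
exists (delete (contract M B) D); split=> //; last first.
  by apply: (pair_coloop_isomorphic gM' neq); rewrite del ?inE ?eqxx ?orbT.
exists B, D; split=> //; first exact: subsetDl.
by rewrite disjoint_sym disjoints_subset; apply/subsetP => x;
  rewrite !inE negb_or => /andP[/andP[]].
Qed.

End PairColoopMatroid.

(** * The two directions of the equivalence *)

Theorem theorem5p2 (T : finType) (M : matroid T) (hM : 2 <= #|ground M|) :
  matroid_connected (direct_sum (uniform 1 2) (uniform 1 1)) M <->
  [/\ loopless M,
      #|[set e in ground M | coloop M e]| <= 1 &
      #|[set e in ground M | free_element M e]| <= 1].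
Proof.
split=> [[_ conn]|[nl col1 free1]].
  have config e f : e \in ground M -> f \in ground M -> e != f ->
      exists B a b c, pair_coloop M B a b c /\ [set e; f] \subset [set a; b; c].
    move=> eE fE nef; have [M' [minM' isoM' sef]] := conn e f eE fE nef.
    have [B [a [b [c [pc gM']]]]] := minor_pair_coloop minM' isoM'.
    by exists B, a, b, c; rewrite -gM'.
  (* Two distinct elements cannot both be [c], so one of them belongs to the parallel pair. *)
  have pair e f : e \in ground M -> f \in ground M -> e != f ->
      exists2 x, x \in [set e; f] & ~~ coloop M x && ~~ free_element M x.
    move=> eE fE nef; have [B [a [b [c [pc sef]]]]] := config e f eE fE nef.
    have ok x : x \in [set a; b] -> ~~ coloop M x && ~~ free_element M x.
      have pc' := pair_coloopC pc; rewrite !inE => /orP[] /eqP ->.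
      - by rewrite (pair_coloop_not_coloop pc) (pair_coloop_not_free pc).
      - by rewrite (pair_coloop_not_coloop pc') (pair_coloop_not_free pc').
    move: sef; rewrite subUset !sub1set => /andP[].
    rewrite inE => /orP[eab _|]; first by exists e; rewrite ?set21 ?ok.
    rewrite inE => /eqP ec; rewrite inE => /orP[fab|].
      by exists f; rewrite ?set22 ?ok.
    by rewrite inE -ec eq_sym (negPf nef).
  have le1 (P : pred T) : (forall x, P x -> coloop M x || free_element M x) ->
      #|[set e in ground M | P e]| <= 1.
    move=> PN; rewrite leqNgt; apply/negP => /card_gt1P[e [f []]].
    rewrite !inE => /andP[eE Pe] /andP[fE Pf] nef.
    have [x] := pair e f eE fE nef; rewrite -negb_or !inE => /orP[] /eqP ->;
    by rewrite PN.
  split; [apply/forall_inP => e eE | apply: le1 => x -> // |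
          by apply: le1 => x ->; rewrite orbT].
  (* A second element [f] gives a configuration covering [e], each of whose three elements is a
     nonloop. *)
  have /set0Pn[f] : ground M :\ e != set0.
    by rewrite -card_gt0; move: hM; rewrite (cardsD1 e) eE.
  case/setD1P => nfe fE; rewrite eq_sym in nfe.
  have [B [a [b [c [pc sef]]]]] := config e f eE fE nfe.
  apply: contraL (pair_coloop_indep1 pc (subsetP sef e (set21 e f))).
  exact: circuit_dep.
split=> // e f eE fE nef.
have uniqueN (P : pred T) : #|[set e in ground M | P e]| <= 1 -> P e -> ~~ P f.
  move=> le1 Pe; apply: contraL le1 => Pf; rewrite -ltnNge.
  by apply/card_gt1P; exists e, f; rewrite !inE eE fE Pe Pf.
have from_nonfree x y : x \in ground M -> y \in ground M -> x != y ->
    ~~ coloop M x -> ~~ free_element M x ->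
    exists B a b c, pair_coloop M B a b c /\ [set x; y] \subset [set a; b; c].
  move=> xE yE nxy ncol nfree.
  have [C [cC xC nsC]] := nonspanning_circuit xE ncol nfree.
  exact: nonspanning_pair_coloop nl cC xC nsC yE nxy.
have nfe : f != e by rewrite eq_sym.
have [B [a [b [c [pc sef]]]]] :
    exists B a b c, pair_coloop M B a b c /\ [set e; f] \subset [set a; b; c].
  (* One of [e], [f] is neither free nor a coloop: if [e] is of either kind, uniqueness keeps [f]
     from being of that kind, and the incompatibility of coloops with free elements excludes the
     other. *)
  have [cole|ncole] := boolP (coloop M e).
    rewrite setUC; apply: from_nonfree => //; first exact: uniqueN cole.
    exact: coloop_not_free cole.
  have [freee|nfreee] := boolP (free_element M e); last exact: from_nonfree.
  rewrite setUC; apply: from_nonfree => //; last exact: uniqueN freee.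
  by apply: contraL freee => /coloop_not_free.
by have [M' [minM' isoM' gM']] := pair_coloop_minor pc; exists M'; rewrite gM'.
Qed.
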